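(* The class of $X$-free ordered graphs is $\chi$-bounded: there is a function $f:\mathbb{N}\to\mathbb{N}$ such that every $X$-free ordered graph $(G,\prec)$ with clique number $\omega$ satisfies $\chi(G)\le f(\omega)$.
   Context: An ordered graph is a pair $(G,\prec)$ where $G$ is a finite graph and $\prec$ is a linear order on $V(G)$. $X$ denotes the ordered graph on vertices $a\prec b\prec c\prec d$ with edge set exactly $\{ac,bd\}$. An ordered graph is $X$-free if it has no four vertices $a\prec b\prec c\prec d$ whose induced ordered subgraph is $X$, i.e. with $ac,bd\in E(G)$ and $ab,bc,cd,ad\notin E(G)$. *)

(* Defs.v *)
From mathcomp Require Import all_boot.
Set Implicit Arguments. Unset Strict Implicit. Unset Printing Implicit Defensive.

Definition simple_graph (T : finType) (E : rel T) : Prop :=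
  symmetric E /\ irreflexive E.

Definition strict_linear_order (T : finType) (lt : rel T) : Prop :=
  irreflexive lt /\ transitive lt /\
  (forall x y : T, x != y -> lt x y || lt y x).

Definition X_free (T : finType) (lt : rel T) (E : rel T) : Prop :=
  ~ (exists a b c d : T,
       [/\ lt a b, lt b c & lt c d] /\
       [/\ E a c, E b d, ~~ E a b, ~~ E b c & ~~ E c d] /\ ~~ E a d).

Definition clique_number (T : finType) (E : rel T) : nat :=
  \max_(K : {set T} | [forall x in K, forall y in K, (x != y) ==> E x y]) #|K|.

(* chromatic number: least k such that T admits a proper colouring c : T -> 'I_k
   (k <= #|T| always suffices; #|T| is the default of the min) *)
Definition chromatic_number (T : finType) (E : rel T) : nat :=
  \big[minn/#|T|]_(k < #|T|.+1 | [exists c : {ffun T -> 'I_k},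
       [forall x, forall y, E x y ==> (c x != c y)]]) k.

(* Main.v *)
Require Import Defs.
From mathcomp Require Import all_boot zify boolp.
Set Implicit Arguments. Unset Strict Implicit. Unset Printing Implicit Defensive.

(** By induction on the clique number the neighbourhood of every vertex is [t]-colourable.  Say that
    an edge is deep in a set if the part of the set between its ends has large chromatic number; a
    set of large chromatic number has deep edges.  A deep edge inside a layer of a breadth-first
    search yields a level: a set [X] of large chromatic number, each [x] in [X] having a neighbour
    [z x], its hair, where the hairs form a stable set of neighbours of one vertex [p] beside [X].
    An edge of [X] passing over a hair [z x] crosses the edge [p (z x)], so one of its ends is adjacent
    to [z x].

    Nested levels whose hairs all lie on one side of the supported set yield a clique consisting of
    hairs.  As cliques are bounded, one may pass to levels that are local: in every interval most
    vertices have their hair in that interval.  A batch of nested local levels either yields a clique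
    of hairs, or contains a level for which every deep edge has an end adjacent to all the hairs
    inside the edge up to a part of small chromatic number.

    Iterating this gives a tower of supports in which every hair is, for each older support,
    adjacent either to all hairs of that support in some interval to its right, or to all those in
    some interval to its left, the side depending only on the two supports.  Ramsey's theorem makes
    the side constant on a long subfamily, and choosing a hair of each support inside the interval
    of the previous one produces a clique. *)

(** * Colourable sets *)

Section Colouring.
Context {V : finType} (E : rel V).

Definition col (A : {set V}) (n : nat) : Prop :=
  exists c : V -> nat,
    (forall x, x \in A -> c x < n) /\
    (forall x y, x \in A -> y \in A -> E x y -> c x != c y).

Definition big (A : {set V}) (n : nat) : Prop := ~ col A n.

Lemma col_sub (A B : {set V}) n : A \subset B -> col B n -> col A n.
Proof.
move=> /subsetP sAB [c [c1 c2]]; exists c; split=> [x /sAB/c1 //|x y /sAB xB /sAB yB].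
exact: c2.
Qed.

Lemma col_leq (A : {set V}) m n : m <= n -> col A m -> col A n.
Proof.
move=> le_mn [c [c1 c2]]; exists c; split=> // x /c1 h; exact: leq_trans h le_mn.
Qed.

Lemma big_sub (A B : {set V}) n : A \subset B -> big A n -> big B n.
Proof. by move=> sAB bA cB; apply: bA; apply: col_sub cB. Qed.

Lemma big_leq (A : {set V}) m n : m <= n -> big A n -> big A m.
Proof. by move=> le_mn bA cA; apply: bA; apply: col_leq cA. Qed.

Lemma col_big (A : {set V}) n : col A n \/ big A n.
Proof. exact: EM. Qed.

Lemma colU (A B : {set V}) m n : col A m -> col B n -> col (A :|: B) (m + n).
Proof.
move=> [c [c1 c2]] [d [d1 d2]].
exists (fun x => if x \in A then c x else m + d x); split.
  by move=> x; rewrite inE; case: ifP => [/c1|_ /= /d1]; lia.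
move=> x y; rewrite !inE; case: ifP => xA; case: ifP => yA //= xB yB Exy.
- exact: c2.
- by have := c1 _ xA; lia.
- by have := c1 _ yA; lia.
- by have := d2 _ _ xB yB Exy; lia.
Qed.

Lemma big_cover (A B C : {set V}) m n :
  A \subset B :|: C -> big A (m + n) -> big B m \/ big C n.
Proof.
move=> sA bA; case: (col_big B m) => [cB|]; last by left.
case: (col_big C n) => [cC|]; last by right.
by case: bA; apply: col_sub sA _; apply: colU.
Qed.

Lemma bigD (A B : {set V}) m n : col B n -> big A (m + n) -> big (A :\: B) m.
Proof.
move=> cB bA; case: (@big_cover A (A :\: B) B m n _ bA) => //.
by apply/subsetP => x xA; rewrite !inE xA; case: (x \in B).
Qed.

Lemma col0 n : col set0 n.
Proof. by exists (fun _ => 0); split=> x; rewrite inE. Qed.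

Lemma big_ex (A : {set V}) n : big A n -> exists x, x \in A.
Proof.
move=> bA; case: (set_0Vmem A) => [A0|[x xA]]; last by exists x.
by case: bA; rewrite A0; apply: col0.
Qed.

(* [f] names the piece of a vertex, [g] the palette of a piece. *)
Lemma col_glue (I : eqType) (A : {set V}) (f : V -> I) (g : V -> nat) k m :
  (forall x, x \in A -> g x < k) ->
  (forall i, col [set x in A | f x == i] m) ->
  (forall x y, x \in A -> y \in A -> E x y -> f x != f y -> g x != g y) ->
  col A (k * m).
Proof.
move=> gk cf gf.
have [c cP] := choice cf.
exists (fun x => g x * m + c (f x) x); split=> [x xA|x y xA yA Exy].
  have [/(_ x)] := cP (f x); rewrite !inE eqxx xA => /(_ isT) h1 _.
  by have := gk _ xA; nia.
have [/(_ x)] := cP (f x); rewrite !inE eqxx xA => /(_ isT) hx hx2.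
have [/(_ y)] := cP (f y); rewrite !inE eqxx yA => /(_ isT) hy _.
case: (eqVneq (f x) (f y)) => [fxy|/(gf _ _ xA yA Exy)/eqP gxy]; last by nia.
case: (eqVneq (g x) (g y)) => [->|/eqP gxy]; last by nia.
rewrite eqn_add2l -fxy; apply: hx2 => //; rewrite !inE ?xA ?yA ?eqxx //.
by rewrite fxy eqxx.
Qed.

(** Splitting by one predicate leaves a part that keeps half of the bound; hence a factor 2 per
    index. *)
Lemma big_pattern (I : eqType) (s : seq I) (P : I -> pred V) (A : {set V}) n :
  big A (2 ^ size s * n) ->
  exists B : {set V}, [/\ B \subset A, big B n &
    forall i, i \in s -> (forall x, x \in B -> P i x) \/ (forall x, x \in B -> ~~ P i x)].
Proof.
elim: s A => [|j s IH] A /=; first by rewrite expn0 mul1n => bA; exists A; split.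
rewrite expnS => bA.
have [b1|b1] : big [set x in A | P j x] (2 ^ size s * n) \/ big [set x in A | ~~ P j x] (2 ^ size s * n).
- apply: (@big_cover A); first by apply/subsetP=> x xA; rewrite !inE xA /=; case: (P j x).
  by apply: big_leq bA; lia.
- have [B [sB bB hB]] := IH _ b1; exists B; split=> //.
    by apply: subset_trans sB _; apply/subsetP=> x; rewrite inE => /andP[].
  move=> i; rewrite inE => /orP[/eqP->|/hB //].
  by left=> x /(subsetP sB); rewrite inE => /andP[].
- have [B [sB bB hB]] := IH _ b1; exists B; split=> //.
    by apply: subset_trans sB _; apply/subsetP=> x; rewrite inE => /andP[].
  move=> i; rewrite inE => /orP[/eqP->|/hB //].
  by right=> x /(subsetP sB); rewrite inE => /andP[].
Qed.

End Colouring.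

(** * Ordered graphs without crossing anticomplete edges *)

(** Positions in [nat] make cuts and intervals arithmetic. *)
Record ograph (V : finType) := OGraph {
  pos : V -> nat;
  adj : rel V;
  pos_inj : injective pos;
  adj_sym : symmetric adj;
  adj_irr : irreflexive adj;
  adj_cross : forall a b c d, pos a < pos b -> pos b < pos c -> pos c < pos d ->
    adj a c -> adj b d -> [|| adj a b, adj b c, adj c d | adj a d] }.

(* [lia] is very slow in the presence of boolean hypotheses that are not arithmetical. *)
Ltac arith_bool b :=
  lazymatch b with
  | leq _ _ => idtac
  | andb ?x ?y => arith_bool x; arith_bool y
  | orb ?x ?y => arith_bool x; arith_bool y
  | negb ?x => arith_bool x
  | @eq_op Datatypes_nat__canonical__eqtype_Equality _ _ => idtac
  end.

Ltac nlia :=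
  repeat match goal with
  | H : is_true ?b |- _ => tryif arith_bool b then fail else clear H
  end; lia.

Section Intervals.
Context {V : finType} (G : ograph V).
Local Notation E := (adj G).
Local Notation pos := (pos G).

Definition itv (i j : nat) : {set V} := [set x | i <= pos x < j].
Definition nbr (v : V) : {set V} := [set y | E v y].
Definition bnd : nat := (\max_(x : V) pos x).+1.

Lemma pos_bnd x : pos x < bnd.
Proof. by rewrite /bnd ltnS; apply: leq_bigmax. Qed.

Lemma in_itv i j x : (x \in itv i j) = (i <= pos x < j).
Proof. by rewrite inE. Qed.

Lemma in_nbr v y : (y \in nbr v) = E v y.
Proof. by rewrite inE. Qed.

Lemma col_point (A : {set V}) i : col E (A :&: itv i i.+1) 1.
Proof.
exists (fun _ => 0); split=> // x y; rewrite !inE => /andP[_ px] /andP[_ py].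
have -> : x = y by apply: (@pos_inj _ G); lia.
by rewrite adj_irr.
Qed.

(* A cut of the order just after the first vertices that are not [m]-colourable. *)
Lemma big_cut (A : {set V}) m n : big E A (m + n + 1) ->
  exists e, big E (A :&: itv 0 e) m /\ big E (A :&: itv e bnd) n.
Proof.
move=> bA.
have exb : exists e, `[< big E (A :&: itv 0 e) m >].
  exists bnd; apply/asboolP; apply: big_sub (big_leq _ bA); last by lia.
  by apply/subsetP=> x xA; rewrite !inE xA pos_bnd.
case: (ex_minnP exb) => e /asboolP be mine; exists e; split=> //.
move=> cn; apply: bA.
have cm : col E (A :&: itv 0 e) (m + 1).
  case: e be mine cn => [|e] be mine _.
    by case: be; apply: col_sub (col0 _ _); apply/subsetP=> x; rewrite !inE; lia.
  have ce : col E (A :&: itv 0 e) m.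
    by case: (col_big E (A :&: itv 0 e) m) => // b; have := mine e; rewrite (asboolT b); lia.
  apply: col_sub (colU ce (col_point A e)); apply/subsetP=> x; rewrite !inE.
  by case: (x \in A) => //=; lia.
have -> : m + n + 1 = (m + 1) + n by lia.
apply: col_sub (colU cm cn); apply/subsetP=> x; rewrite !inE => -> /=.
by have := pos_bnd x; lia.
Qed.

(** Greedy blocks: each block stops as soon as it is no longer [b]-colourable, so one more colour
    suffices for it, and vertices of non-consecutive blocks have a whole block between them. The
    third clause carries this across the first cut in the induction. *)
Lemma block_partition (C : {set V}) b k m : bnd <= m + k ->
  exists f : V -> nat, [/\
    forall i, col E [set x in C :&: itv m bnd | f x == i] b.+1,
    forall x y, x \in C -> y \in C -> m <= pos x -> m <= pos y -> (f x).+1 < f y ->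
      pos x < pos y /\ big E (C :&: itv (pos x).+1 (pos y)) b &
    forall y, y \in C -> m <= pos y -> 0 < f y -> big E (C :&: itv m (pos y)) b].
Proof.
elim/ltn_ind: k m => k IH m hk.
case: (EM (exists e, `[< big E (C :&: itv m e) b >])) => [exb|nob]; last first.
  exists (fun _ => 0); split=> // i.
  apply: (@col_leq _ _ _ b); first by lia.
  case: (col_big E (C :&: itv m bnd) b) => [c|c]; last by case: nob; exists bnd; apply/asboolP.
  by apply: col_sub c; apply/subsetP=> x; rewrite !inE => /andP[].
case: (ex_minnP exb) => e /asboolP be mine.
have lt_me : m < e.
  rewrite ltnNge; apply/negP => le_em; apply: be; apply: col_sub (col0 _ _).
  by apply/subsetP=> x; rewrite !inE; lia.
have [x0 x0in] := big_ex be.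
have lt_mb : m < bnd by move: x0in (pos_bnd x0); rewrite !inE; lia.
have le_eb : e <= bnd.
  apply: mine; apply/asboolP; apply: big_sub be; apply/subsetP=> x.
  by rewrite !inE => /andP[-> /=] /andP[-> _]; apply: pos_bnd.
have [||f [f1 f2 f3]] := IH (k - (e - m)) _ e; [by lia|by lia|].
exists (fun x => if pos x < e then 0 else (f x).+1); split.
- case=> [|i].
    have ce : col E (C :&: itv m e.-1) b.
      case: (col_big E (C :&: itv m e.-1) b) => // c.
      by have := mine e.-1; rewrite (asboolT c); lia.
    rewrite -addn1; apply: col_sub (colU ce (col_point C e.-1)).
    apply/subsetP=> x; rewrite !inE; case: ifP => pxe; case: (x \in C) => //=; lia.
  apply: col_sub (f1 i); apply/subsetP=> x; rewrite !inE.
  by case: ifP => pxe; case: (x \in C) => //=; lia.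
- move=> x y xC yC mx my; case: ifP => pxe; case: ifP => pye //= lt_f.
    split; first by lia.
    apply: big_sub (f3 y yC _ _); [|lia|lia].
    by apply/subsetP=> z; rewrite !inE; lia.
  by apply: f2 => //; lia.
- move=> y yC my; case: ifP => pye // _; apply: big_sub be.
  by apply/subsetP=> z; rewrite !inE; lia.
Qed.

(** Otherwise every edge lies in a block or joins consecutive blocks, and two palettes of [b.+1]
    colours, alternating with the parity of the block, colour [C]. *)
Lemma deep_edge (C : {set V}) b : big E C (2 * b.+1) ->
  exists u v, [/\ u \in C, v \in C, E u v, pos u < pos v &
    big E (C :&: itv (pos u).+1 (pos v)) b].
Proof.
move=> bC; apply: contrapT => nod; apply: bC.
have [|f [f1 f2 _]] := @block_partition C b bnd 0; first by lia.
have noE x y : x \in C -> y \in C -> E x y -> ~~ ((f x).+1 < f y).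
  move=> xC yC Exy; apply/negP => /(f2 _ _ xC yC isT isT) [lt_xy bxy].
  by apply: nod; exists x, y; split.
apply: (@col_glue _ E _ C f (fun x => odd (f x))) => [x _|i|x y xC yC Exy fxy].
- by case: odd.
- apply: col_sub (f1 i); apply/subsetP=> x; rewrite !inE => /andP[-> ->].
  by rewrite pos_bnd.
- have := noE x y xC yC Exy; rewrite adj_sym in Exy; have := noE y x yC xC Exy.
  by lia.
Qed.

End Intervals.

(** * Supporting a set from the neighbourhood of one vertex *)

Section Levels.
Context {V : finType} (G : ograph V).
Local Notation E := (adj G).
Local Notation pos := (pos G).
Local Notation itv := (itv G).
Local Notation nbr := (nbr G).

(** Breadth-first search in the graph induced on [D]: [rt] picks a root in each component and [d] is
    the distance to it. *)
Lemma distance_layers (D : {set V}) : exists (rt : V -> V) (d : V -> nat), [/\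
  forall x y, x \in D -> y \in D -> E x y -> rt x = rt y,
  forall x y, x \in D -> y \in D -> E x y -> d y <= (d x).+1,
  forall x k, x \in D -> d x = k.+1 -> exists y, [/\ y \in D, E x y & d y = k] &
  forall x, x \in D -> d x = 0 -> x = rt x].
Proof.
pose e x y := [&& x \in D, y \in D & E x y].
have e_sym : symmetric e by move=> x y; rewrite /e adj_sym andbCA.
have ce : connect_sym e by exact: sym_connect_sym.
pose R n r := iter n (fun S => S :|: [set y | [exists x in S, e x y]]) [set r].
have R1 n r x y : x \in R n r -> e x y -> y \in R n.+1 r.
  by move=> xR xy /=; rewrite !inE; apply/orP; right; apply/existsP; exists x; rewrite xR.
have conR r x : connect e r x -> exists n, x \in R n r.
  case/connectP=> s sp ->; elim/last_ind: s sp => [|s y IH].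
    by exists 0; rewrite /R /= inE.
  rewrite rcons_path last_rcons => /andP[/IH [n hn] ey].
  by exists n.+1; apply: R1 hn ey.
have exR x : exists n, x \in R n (root e x) by apply: conR; rewrite ce connect_root.
pose d x := ex_minn (exR x).
have dR x : x \in R (d x) (root e x) by rewrite /d; case: ex_minnP.
have dmin x n : x \in R n (root e x) -> d x <= n.
  by move=> xR; rewrite /d; case: ex_minnP => m _; apply.
have rtE x y : e x y -> root e x = root e y by move=> xy; apply/rootP=> //; apply: connect1.
have eI x y : x \in D -> y \in D -> E x y -> e x y by rewrite /e => -> ->.
have d1 x y : e x y -> d y <= (d x).+1.
  by move=> xy; apply: dmin; rewrite -(rtE _ _ xy); apply: R1 (dR x) xy.
exists (root e), d; split=> [x y xD yD xy|x y xD yD xy|x k xD dx|x xD dx].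
- by apply: rtE; apply: eI.
- by apply: d1; apply: eI.
- have := dR x; rewrite dx /= !inE => /orP[|/existsP[y /andP[yR yx]]].
    by move/dmin; nlia.
  exists y; have [yD _ Eyx] := and3P yx; split=> //; first by rewrite adj_sym.
  have := d1 _ _ yx; rewrite dx => dy.
  have : d y <= k by apply: dmin; rewrite (rtE _ _ yx).
  by nlia.
- by have := dR x; rewrite dx /= inE => /eqP.
Qed.

(* [z x] is the hair of [x]; the hairs form a stable set of neighbours of a vertex [p] that misses
   [X] and lies on one side of it. *)
Definition level (p : V) (z : {ffun V -> V}) (X : {set V}) : Prop := [/\
  forall x, x \in X -> [/\ E x (z x), E p (z x) & ~~ E p x],
  forall x y, x \in X -> y \in X -> ~~ E (z x) (z y) &
  (forall x, x \in X -> pos p < pos x) \/ (forall x, x \in X -> pos x < pos p)].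

(* Otherwise the edges [p (z x)] and [a b] would form an [X]. *)
Lemma level_hair p z X x a b : level p z X -> x \in X -> a \in X -> b \in X ->
  E a b -> pos a < pos (z x) < pos b -> E a (z x) || E b (z x).
Proof.
move=> [h1 _ h3] xX aX bX ab /andP[az zb].
have [_ pz px] := h1 _ xX; have [_ _ pa] := h1 _ aX; have [_ _ pb] := h1 _ bX.
case: h3 => h3.
  have := @adj_cross _ G p a (z x) b (h3 _ aX) az zb pz ab.
  by rewrite (negbTE pa) (negbTE pb) orbF /= [E _ b]adj_sym.
have := @adj_cross _ G a (z x) b p az zb (h3 _ bX) ab.
rewrite [E _ p]adj_sym pz => /(_ isT).
by rewrite [E b p]adj_sym [E a p]adj_sym (negbTE pa) (negbTE pb) !orbF [E _ b]adj_sym.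
Qed.

(** When [z x] lies outside the interval between [u] and [v], the edge [x (z x)] crosses [u v];
    otherwise [level_hair] applies. *)
Lemma level_cross p z X x u v : level p z X -> x \in X -> u \in X -> v \in X ->
  E u v -> pos u < pos x < pos v -> ~~ E u x -> ~~ E v x -> E u (z x) || E v (z x).
Proof.
move=> lev xX uX vX uv /andP[ux xv] Nux Nvx.
have [h1 _ _] := lev; have [xz _ _] := h1 _ xX.
have zu : pos (z x) <> pos u by move/pos_inj => zu; rewrite adj_sym zu (negbTE Nux) in xz.
have zv : pos (z x) <> pos v by move/pos_inj => zv; rewrite adj_sym zv (negbTE Nvx) in xz.
case: (ltnP (pos (z x)) (pos u)) => zxu.
  have := @adj_cross _ G (z x) u x v zxu ux xv; rewrite adj_sym xz uv => /(_ isT isT).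
  by rewrite (negbTE Nux) [E x v]adj_sym (negbTE Nvx) /= ![E (z x) _]adj_sym.
case: (ltnP (pos (z x)) (pos v)) => zxv; first by apply: level_hair lev _ _ _ uv _ => //; nlia.
have := @adj_cross _ G u x v (z x) ux xv; rewrite uv xz => /(_ _ isT isT).
rewrite (negbTE Nux) [E x v]adj_sym (negbTE Nvx) /= orbC; apply; nlia.
Qed.

(** The losses, from the outside in: parity of the layer, removal of the root, side of the root,
    deep edge, neighbourhoods of its two ends, choice of an end as [p], colour class of the
    hairs. *)
Definition levelM t n := 2 * (2 * (2 * (2 * (t * n) + (t + t)).+1) + 1).

Lemma level_ex t (D : {set V}) n : (forall v, col E (nbr v) t) -> big E D (levelM t n) ->
  exists (p : V) (z : {ffun V -> V}) (X : {set V}), [/\ X \subset D, level p z X,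
    forall x, x \in X -> z x \in D & big E X n].
Proof.
move=> ht bD; have [rt [d [d1 d2 d3 d4]]] := distance_layers D.
set m := 2 * (2 * (2 * (t * n) + (t + t)).+1) + 1 in bD.
(* Edges stay in a layer or join consecutive layers of one component, so the parity of the distance
   can select the palette. *)
have [r [k bC]] : exists r k, big E [set x in D | (rt x, d x) == (r, k)] m.
  apply: contrapT => noC; apply: bD.
  apply: (@col_glue _ E _ D (fun x => (rt x, d x)) (fun x => odd (d x))).
  - by move=> x _; case: odd.
  - move=> [r k]; case: (col_big E [set x in D | (rt x, d x) == (r, k)] m) => // b.
    by case: noC; exists r, k.
  - move=> x y xD yD xy; rewrite xpair_eqE (d1 _ _ xD yD xy) eqxx /= => dxy.
    have := d2 _ _ xD yD xy; rewrite adj_sym in xy; have := d2 _ _ yD xD xy; nlia.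
set C0 := [set x in D | _] in bC.
(* With [C] on one side of the root, the root is never between two vertices of [C]. *)
have [C [sC rC bC']] : exists C : {set V}, [/\ C \subset C0,
    (forall x, x \in C -> pos r < pos x) \/ (forall x, x \in C -> pos x < pos r) &
    big E C (2 * (2 * (t * n) + (t + t)).+1)].
  have : big E (C0 :\: itv (pos r) (pos r).+1) (2 * (2 * (2 * (t * n) + (t + t)).+1)).
    apply: (bigD _ bC); apply: col_sub (col_point G setT (pos r)).
    by apply/subsetP=> x; rewrite !inE.
  rewrite mul2n -addnn => bC1.
  case: (@big_cover _ E _ [set x in C0 | pos r < pos x] [set x in C0 | pos x < pos r] _ _ _ bC1).
  - by apply/subsetP=> x; rewrite !inE => /andP[? ->] /=; nlia.
  - by exists [set x in C0 | pos r < pos x]; split=> //; [apply/subsetP=> x|left=> x]; rewrite inE => /andP[].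
  - by exists [set x in C0 | pos x < pos r]; split=> //; [apply/subsetP=> x|right=> x]; rewrite inE => /andP[].
have [u [v [uC vC uv lt_uv bY]]] := deep_edge bC'.
have CP x : x \in C -> [/\ x \in D, rt x = r & d x = k].
  by move/(subsetP sC); rewrite inE => /andP[xD /eqP[]].
clear bD m bC sC C0 bC'.
have [uD ru du] := CP _ uC; have [vD rv dv] := CP _ vC.
(* No vertex at distance less than [k - 1] from the root lies between [u] and [v]: the root does not,
   and the next such vertex on a shortest path would give an edge crossing [u v]. *)
have out j y : j.+1 < k -> y \in D -> rt y = r -> d y = j -> ~~ (pos u < pos y < pos v).
  elim: j y => [|j IH] y jk yD ry dy.
    have := d4 _ yD dy; rewrite ry => ->.
    by case: rC => rC; have := rC _ uC; have := rC _ vC; nlia.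
  apply/negP => yuv; have [w [wD yw dw]] := d3 _ _ yD dy.
  have rw : rt w = r by rewrite -ry; symmetry; apply: d1.
  have := IH w (ltnW jk) wD rw dw.
  have far a b : a \in D -> b \in D -> d a <= j.+1 -> d b = k -> ~~ E a b.
    by move=> aD bD0 da db; apply/negP=> ab; have := d2 _ _ aD bD0 ab; nlia.
  have Ny b : b \in D -> d b = k -> ~~ E y b by move=> bD0; apply: far => //; nlia.
  have Nw b : b \in D -> d b = k -> ~~ E w b by move=> bD0; apply: far => //; nlia.
  have wu : pos w <> pos u by move/pos_inj=> h; move: dw; rewrite h du; nlia.
  have wv : pos w <> pos v by move/pos_inj=> h; move: dw; rewrite h dv; nlia.
  move=> wuv; case: (ltnP (pos w) (pos u)) => pwu.
    have := @adj_cross _ G w u y v pwu; rewrite adj_sym yw uv.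
    case/andP: yuv => -> -> /(_ isT isT isT isT).
    by rewrite [E u y]adj_sym (negbTE (Ny _ vD dv)) (negbTE (Ny _ uD du))
       (negbTE (Nw _ vD dv)) (negbTE (Nw _ uD du)).
  have pwv : pos v < pos w by nlia.
  have := @adj_cross _ G u y v w; rewrite yw uv pwv.
  case/andP: yuv => -> -> /(_ isT isT isT isT isT).
  by rewrite [E u y]adj_sym [E v w]adj_sym [E u w]adj_sym (negbTE (Ny _ vD dv))
     (negbTE (Ny _ uD du)) (negbTE (Nw _ vD dv)) (negbTE (Nw _ uD du)).
set Y := (C :&: _) in bY.
have bY2 : big E ((Y :\: nbr u) :\: nbr v) (2 * (t * n)).
  by apply: bigD (ht v) _; apply: bigD (ht u) _; rewrite -addnA.
(* The hair is a neighbour [y] of [x] one step nearer the root. If [y] is outside the interval of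
   [u v], the edge [x y] crosses [u v]. If it is inside, it is not the root; its own neighbour [w]
   nearer the root is outside by [out] and too near the root to meet [u] or [v], and [y w] crosses
   [u v]. *)
have [z zP] : exists z : {ffun V -> V}, forall x, x \in (Y :\: nbr u) :\: nbr v ->
    [/\ z x \in D, E x (z x) & E u (z x) || E v (z x)].
  suff /choice [z zP] : forall x, exists y, x \in (Y :\: nbr u) :\: nbr v ->
      [/\ y \in D, E x y & E u y || E v y].
    by exists (finfun z) => x xY; rewrite ffunE; apply: zP.
  move=> x; case: (boolP (x \in _)) => xY; last by exists x.
  move: xY; rewrite !inE => /and3P[Nvx Nux /andP[xC xuv]].
  have [xD rx dx] := CP _ xC.
  case: k => [|k] in CP du dv out dx *.
    by have := d4 _ xD dx; have := d4 _ uD du; rewrite ru rx => <- xu; move: xuv; rewrite xu; nlia.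
  have [y [yD xy dy]] := d3 _ _ xD dx; exists y => _; split=> //.
  have ry : rt y = r by rewrite -rx; symmetry; apply: d1.
  have yu : pos y <> pos u by move/pos_inj=> h; move: dy; rewrite h du; nlia.
  have yv : pos y <> pos v by move/pos_inj=> h; move: dy; rewrite h dv; nlia.
  case: (ltnP (pos y) (pos u)) => pyu.
    have := @adj_cross _ G y u x v pyu; rewrite adj_sym xy uv (negbTE Nux).
    rewrite [E x v]adj_sym (negbTE Nvx) ![E y _]adj_sym /=; apply=> //; nlia.
  case: (ltnP (pos v) (pos y)) => pyv.
    have := @adj_cross _ G u x v y; rewrite xy uv (negbTE Nux).
    rewrite [E x v]adj_sym (negbTE Nvx) /= orbC; apply=> //; nlia.
  have yuv : pos u < pos y < pos v by nlia.
  case: k => [|k] in CP du dv out dx dy *.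
    have := d4 _ yD dy; rewrite ry => h; move: yuv; rewrite h.
    by case: rC => rC; have := rC _ uC; have := rC _ vC; nlia.
  have [w [wD yw dw]] := d3 _ _ yD dy.
  have rw : rt w = r by rewrite -ry; symmetry; apply: d1.
  have wuv := out _ _ (ltnSn _) wD rw dw.
  have Nw b : b \in D -> d b = k.+2 -> ~~ E w b.
    by move=> bD0 db; apply/negP=> wb; have := d2 _ _ wD bD0 wb; nlia.
  have wu : pos w <> pos u by move/pos_inj=> h; move: dw; rewrite h du; nlia.
  have wv : pos w <> pos v by move/pos_inj=> h; move: dw; rewrite h dv; nlia.
  case: (ltnP (pos w) (pos u)) => pwu.
    have := @adj_cross _ G w u y v pwu; rewrite adj_sym yw uv.
    rewrite (negbTE (Nw _ vD dv)) (negbTE (Nw _ uD du)) orbF /= [E y v]adj_sym.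
    by case/andP: yuv => -> -> /(_ isT isT isT isT).
  have := @adj_cross _ G u y v w; rewrite yw uv.
  rewrite [E v w]adj_sym [E u w]adj_sym (negbTE (Nw _ vD dv)) (negbTE (Nw _ uD du)) !orbF.
  by rewrite [E y v]adj_sym; case/andP: yuv => -> -> /(_ isT isT _ isT isT); apply; nlia.
set Y2 := (Y :\: nbr u) :\: nbr v in bY2 zP.
have Y2P x : x \in Y2 -> [/\ x \in D, pos u < pos x < pos v, ~~ E u x & ~~ E v x].
  rewrite !inE => /and3P[Nvx Nux /andP[xC xuv]]; have [xD _ _] := CP _ xC.
  by split=> //; nlia.
have [p [Z [sZ pZ Np bZ]]] : exists p (Z : {set V}), [/\ Z \subset Y2,
    forall x, x \in Z -> E p (z x) && ~~ E p x,
    (forall x, x \in Z -> pos p < pos x) \/ (forall x, x \in Z -> pos x < pos p) &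
    big E Z (t * n)].
  move: bY2; rewrite mul2n -addnn => bY2.
  case: (@big_cover _ E _ [set x in Y2 | E u (z x)] [set x in Y2 | E v (z x)] _ _ _ bY2) => [|b|b].
  - apply/subsetP=> x xY; have [_ _ /orP[h|h]] := zP _ xY; apply/setUP.
      by left; apply/setIdP.
    by right; apply/setIdP.
  - exists u, [set x in Y2 | E u (z x)]; split=> //.
    + by apply/subsetP=> x /setIdP[].
    + by move=> x /setIdP[/Y2P[_ _ -> _] ->].
    + by left=> x /setIdP[/Y2P[_ /andP[]]].
  - exists v, [set x in Y2 | E v (z x)]; split=> //.
    + by apply/subsetP=> x /setIdP[].
    + by move=> x /setIdP[/Y2P[_ _ _ ->] ->].
    + by right=> x /setIdP[/Y2P[_ /andP[]]].
(* A colouring of the neighbours of [p] sorts the hairs into [t] stable classes. *)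
have [c [c1 c2]] := ht p.
have [i bX] : exists i, big E [set x in Z | c (z x) == i] n.
  apply: contrapT => noX; apply: bZ.
  apply: (@col_glue _ E _ Z (fun x => c (z x)) (fun x => c (z x))) => //.
    by move=> x /pZ /andP[pz _]; apply: c1; rewrite inE.
  by move=> i; case: (col_big E [set x in Z | c (z x) == i] n) => // b; case: noX; exists i.
exists p, z, [set x in Z | c (z x) == i].
have XZ x : x \in [set x in Z | c (z x) == i] -> [/\ x \in Z, x \in Y2 & c (z x) = i].
  by rewrite inE => /andP[xZ /eqP]; split=> //; apply: (subsetP sZ).
split=> //.
- by apply/subsetP=> x /XZ [_ /Y2P[]].
- split=> [x /XZ [xZ xY _]|x y /XZ[xZ _ cx] /XZ[yZ _ cy]|].
  + by have [_ ->] := zP _ xY; have /andP[-> ->] := pZ _ xZ.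
  + apply/negP=> xy; have := c2 (z x) (z y); rewrite !inE cx cy eqxx.
    by have /andP[-> _] := pZ _ xZ; have /andP[-> _] := pZ _ yZ => /(_ isT isT xy).
  + by case: Np => Np; [left|right] => x /XZ[xZ _ _]; apply: Np.
- by move=> x /XZ[_ xY _]; case: (zP _ xY).
Qed.

End Levels.

(** * Supports lying outside the supported set *)

Section Outer.
Context {V : finType} (G : ograph V).
Local Notation E := (adj G).
Local Notation pos := (pos G).
Local Notation itv := (itv G).
Local Notation nbr := (nbr G).

(* The most recent support comes first. *)
Definition outer (D : {set V}) (zs : seq {ffun V -> V}) : Prop :=
  (forall z, z \in zs -> [/\ forall x, x \in D -> E x (z x),
     forall x y, x \in D -> y \in D -> pos (z x) < pos y &
     forall x y, x \in D -> y \in D -> ~~ E (z x) (z y)]) /\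
  pairwise (fun z z' : {ffun V -> V} =>
    [forall x in D, forall y in D, pos (z' y) < pos (z x)]) zs.

Lemma big_avoid (I : eqType) (s : seq I) (F : I -> {set V}) (A : {set V}) m :
  (forall i, col E (F i) m) -> big E A (m * size s) ->
  exists x, x \in A /\ forall i, i \in s -> x \notin F i.
Proof.
move=> cF; elim: s A => [|i s IH] A /=.
  by rewrite muln0 => /big_ex [x xA]; exists x.
rewrite mulnS addnC => /(bigD (cF i)) /IH [x []]; rewrite inE => /andP[xi xA] h.
by exists x; split=> // j; rewrite inE => /orP[/eqP->|/h].
Qed.

Fixpoint outerM t n :=
  if n is n'.+1 then (outerM t n' + (t + t)) + (t + t) * n' + 1 else 0.

Lemma outerM_mono t : {homo outerM t : m n / m <= n}.
Proof. by apply: homo_leq => // [m n p|n /=]; nlia. Qed.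

Section FarthestHair.
Variables (D : {set V}) (z : {ffun V -> V}).
Hypothesis zD : forall x, x \in D -> E x (z x).

(** With the rightmost choice, any hair over [D] farther to the right is known to be nonadjacent to
    [x]. *)
Definition farthest_hair : {ffun V -> V} :=
  [ffun x => [arg max_(y > z x | (y \in [set z w | w in D]) && E x y) pos y]].

Lemma farthest_hairP x : x \in D -> [/\ exists2 w, w \in D & farthest_hair x = z w, E x (farthest_hair x) &
  forall w, w \in D -> E x (z w) -> pos (z w) <= pos (farthest_hair x)].
Proof.
move=> xD; rewrite ffunE; case: arg_maxnP => [|y /andP[/imsetP[w wD ->] Exy] ymax].
  by rewrite zD // andbT; apply/imsetP; exists x.
split=> //; first by exists w.
by move=> w' wD' Exw'; apply: ymax; rewrite Exw' andbT; apply/imsetP; exists w'.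
Qed.

End FarthestHair.

(** A vertex [d] on the right is chosen so that the newest hair [z d] is adjacent to the farthest
    hairs of all older supports over a large [D']. Recursion on [D'], with farthest hairs in place
    of hairs, yields the rest of the clique. *)
Lemma outer_clique t n (D : {set V}) (zs : seq {ffun V -> V}) :
  (forall v, col E (nbr v) t) -> size zs = n -> outer D zs -> big E D (outerM t n) ->
  exists s : seq V, [/\ size s = n, pairwise E s &
    forall v, v \in s -> exists2 z, z \in zs & exists2 x, x \in D & v = z x].
Proof.
move=> ht; elim: n D zs => [|n IH] D [|z zs] //=; first by exists [::].
move=> [sz] [oz /andP[pz pzs]] bD.
have [e [bL bR]] := big_cut bD.
set L := D :&: itv 0 e in bL; set R := D :&: itv e _ in bR.
have LD x : x \in L -> x \in D /\ pos x < e by rewrite !inE => /and3P[].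
have RD x : x \in R -> x \in D /\ e <= pos x by rewrite !inE => /and3P[].
have [l0 l0L] := big_ex bL.
have zP z' : z' \in zs -> [/\ forall x, x \in D -> E x (z' x),
     forall x y, x \in D -> y \in D -> pos (z' x) < pos y &
     forall x y, x \in D -> y \in D -> ~~ E (z' x) (z' y)].
  by move=> h; apply: oz; rewrite inE h orbT.
(* The vertex of [L] with the leftmost farthest hair: a bound obtained for it holds on all of
   [L]. *)
pose lm z' := [arg min_(l < l0 | l \in L) pos (farthest_hair D z' l)].
have lmP z' : lm z' \in L /\ forall l, l \in L -> pos (farthest_hair D z' (lm z')) <= pos (farthest_hair D z' l).
  by rewrite /lm; case: arg_minnP.
have [d [dR dN]] := big_avoid (F := fun z' => nbr (lm z') :|: nbr (farthest_hair D z' (lm z')))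
   (fun z' => colU (ht _) (ht _)) (eq_ind_r (fun m => big E R ((t + t) * m)) bR sz).
have [dD ed] := RD _ dR.
(* Otherwise the edges from [lm z'] and [d] to their farthest hairs cross, and the one adjacency
   left gives [lm z'] a neighbour beyond its farthest hair. *)
have lowd z' : z' \in zs -> pos (farthest_hair D z' d) < pos (farthest_hair D z' (lm z')).
  move=> z'in; have [h1 h2 h3] := zP _ z'in.
  have [lL _] := lmP z'; have [lD le] := LD _ lL.
  have [[w wD rw] ldw mw] := farthest_hairP h1 dD.
  have [[w' wD' rw'] llw mw'] := farthest_hairP h1 lD.
  have := dN _ z'in; rewrite !inE negb_or => /andP[Nld Nrd].
  rewrite ltnNge leq_eqVlt negb_or; apply/andP; split.
    by apply/negP => /eqP /pos_inj eqr; rewrite adj_sym eqr ldw in Nrd.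
  apply/negP => lt.
  have lt2 : pos (farthest_hair D z' d) < pos (lm z') by rewrite rw; apply: h2.
  have := @adj_cross _ G (farthest_hair D z' (lm z')) (farthest_hair D z' d) (lm z') d lt lt2 (leq_trans le ed).
  rewrite [E _ (lm z')]adj_sym llw [E _ d]adj_sym ldw => /(_ isT isT).
  rewrite (negbTE Nld) (negbTE Nrd) !orbF {1}rw' {1}rw (negbTE (h3 _ _ wD' wD)) /=.
  rewrite adj_sym rw => /(mw' _ wD); rewrite -rw; nlia.
have [zD zlt zind] := oz z (mem_head _ _).
have bD' : big E ((L :\: nbr d) :\: nbr (z d)) (outerM t n).
  by apply: bigD (ht _) _; apply: bigD (ht _) _; rewrite -addnA.
set D' := (L :\: _) :\: _ in bD'.
have D'P x : x \in D' -> [/\ x \in D, pos x < e, ~~ E d x & ~~ E (z d) x].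
  by rewrite !inE => /and3P[-> -> /and3P[-> _ ->]].
have D'D x : x \in D' -> x \in D by case/D'P.
(* The edge from [x] to its farthest hair crosses [d (z d)]. That hair lies beyond the farthest hair
   of [d], so it is not adjacent to [d], and must be adjacent to [z d]. *)
have adjs z' x : z' \in zs -> x \in D' -> E (z d) (farthest_hair D z' x).
  move=> z'in xD'; have [xD xe Ndx Nsx] := D'P _ xD'; have [h1 h2 h3] := zP _ z'in.
  have [[w wD rw] xrx mx] := farthest_hairP h1 xD.
  have lt1 : pos (farthest_hair D z' x) < pos (z d).
    rewrite rw; have := allP pz _ z'in.
    by move=> /forall_inP/(_ _ dD)/forall_inP/(_ _ wD).
  have := @adj_cross _ G (farthest_hair D z' x) (z d) x d lt1 (zlt _ _ dD xD).
  rewrite (leq_trans xe ed) adj_sym xrx adj_sym zD // => /(_ isT isT isT).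
  rewrite (negbTE Nsx) [E x d]adj_sym (negbTE Ndx) /= => /orP[|Erd]; first by rewrite adj_sym.
  have [_ mind] := lmP z'.
  have xL : x \in L by move: xD'; rewrite inE => /andP[_]; rewrite inE => /andP[].
  have := mind _ xL; have := lowd _ z'in.
  have [_ _ md] := farthest_hairP h1 dD; rewrite adj_sym rw in Erd.
  by have := md _ wD Erd; rewrite -rw; nlia.
have [||//|s [ss ps hs]] := IH D' (map (farthest_hair D) zs); first by rewrite size_map.
  split=> [z' /mapP[z1 z1in ->]|].
    have [h1 h2 h3] := zP _ z1in; split=> [x /D'D xD|x y /D'D xD /D'D yD|x y /D'D xD /D'D yD].
    + by have [] := farthest_hairP h1 xD.
    + by have [[w wD ->] _ _] := farthest_hairP h1 xD; apply: h2.
    + have [[w wD ->] _ _] := farthest_hairP h1 xD; have [[w' wD' ->] _ _] := farthest_hairP h1 yD; exact: h3.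
  rewrite pairwise_map; apply: (sub_in_pairwise (P := mem zs)) pzs; last by apply/allP.
  move=> z1 z2 z1in z2in /= /forall_inP h.
  apply/forall_inP=> x /D'D xD; apply/forall_inP=> y /D'D yD.
  have [h1 _ _] := zP _ z1in; have [h2 _ _] := zP _ z2in.
  have [[w wD ->] _ _] := farthest_hairP h1 xD; have [[w' wD' ->] _ _] := farthest_hairP h2 yD.
  by have /forall_inP := h _ wD; apply.
exists (z d :: s); split=> /=; first by rewrite ss.
- rewrite ps andbT; apply/allP=> v /hs [z' /mapP[z1 z1in ->] [x xD' ->]].
  exact: adjs.
- move=> v; rewrite inE => /orP[/eqP->|/hs [z' /mapP[z1 z1in ->] [x xD' ->]]].
    by exists z; [apply: mem_head|exists d].
  have [h1 _ _] := zP _ z1in; have [[w wD ->] _ _] := farthest_hairP h1 (D'D _ xD').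
  by exists z1; [rewrite inE z1in orbT|exists w].
Qed.

End Outer.

(** * Reversing the order *)

Section Reverse.
Context {V : finType} (G : ograph V).

Lemma rev_pos_inj : injective (fun x => bnd G - pos G x).
Proof.
by move=> x y h; apply: (@pos_inj _ G); have := pos_bnd G x; have := pos_bnd G y; lia.
Qed.

Lemma rev_cross a b c d : bnd G - pos G a < bnd G - pos G b ->
  bnd G - pos G b < bnd G - pos G c -> bnd G - pos G c < bnd G - pos G d ->
  adj G a c -> adj G b d -> [|| adj G a b, adj G b c, adj G c d | adj G a d].
Proof.
move=> ab bc cd ac bd; have h := @adj_cross _ G d c b a.
have := h _ _ _ _ _; rewrite ![adj G d _]adj_sym [adj G c b]adj_sym [adj G b a]adj_sym.
rewrite [adj G c a]adj_sym => h'.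
suff : [|| adj G c d, adj G b c, adj G a b | adj G a d].
  by case/or4P=> ->; rewrite ?orbT.
by apply: h' => //; nlia.
Qed.

Definition rev_graph : ograph V :=
  OGraph rev_pos_inj (@adj_sym _ G) (@adj_irr _ G) rev_cross.

Lemma rev_itv i j : itv rev_graph i j = itv G ((bnd G).+1 - j) ((bnd G).+1 - i).
Proof. by apply/setP=> x; rewrite !inE /=; have := pos_bnd G x; lia. Qed.

End Reverse.

(** * Local supports *)

Section Local.
Context {V : finType} (G : ograph V).
Local Notation E := (adj G).
Local Notation pos := (pos G).
Local Notation itv := (itv G).
Local Notation nbr := (nbr G).
Local Notation bnd := (bnd G).

(* In every interval, few vertices have their hair outside the interval. *)
Definition loc (g : nat) (z : {ffun V -> V}) (X : {set V}) : Prop :=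
  forall i j, col E [set x in X :&: itv i j | z x \notin itv i j] g.

Lemma loc_leq g h z X : g <= h -> loc g z X -> loc h z X.
Proof. by move=> gh lX i j; apply: col_leq gh _. Qed.

Lemma outer_sub (D X : {set V}) zs : X \subset D -> outer G D zs -> outer G X zs.
Proof.
move=> /subsetP sXD [h1 h2]; split=> [z /h1 [a b c]|].
  split=> [x /sXD|x y /sXD xD /sXD yD|x y /sXD xD /sXD yD]; [exact: a|exact: b|exact: c].
apply: sub_pairwise h2 => z z' /forall_inP h.
by apply/forall_inP=> x /sXD /h /forall_inP h'; apply/forall_inP=> y /sXD; apply: h'.
Qed.

(** The new hairs lie in [D], hence to the right of all older hairs. *)
Lemma outer_cons p z (D X X1 : {set V}) zs i : outer G D zs -> X \subset D -> X1 \subset X ->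
  level G p z X -> (forall x, x \in X -> z x \in D) ->
  (forall x, x \in X1 -> pos (z x) < i <= pos x) -> outer G X1 (z :: zs).
Proof.
move=> oD sXD sX1 [l1 l2 _] zD zi; have sX1D := subset_trans sX1 sXD.
have [o1 o2] := outer_sub sX1D oD; have [oD1 _] := oD.
split=> [z'|/=].
  rewrite inE => /orP[/eqP->|/o1 //]; split=> [x /(subsetP sX1)/l1 []//|x y xX yX|x y xX yX].
    have h1 := zi _ xX; have h2 := zi _ yX; move: h1 h2 => /andP[h1 _] /andP[_ h2].
    exact: leq_trans h1 h2.
  by apply: l2; apply: (subsetP sX1).
rewrite o2 andbT; apply/allP=> z' z'in; have [_ h _] := oD1 _ z'in.
apply/forall_inP=> x /(subsetP sX1) /zD zx; apply/forall_inP=> y /(subsetP sX1D) yD.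
exact: h.
Qed.

End Local.

(** * Batches of nested local levels *)

Section Batches.
Context {V : finType} (G : ograph V) (t K : nat).
Local Notation E := (adj G).
Local Notation pos := (pos G).
Local Notation itv := (itv G).
Local Notation nbr := (nbr G).
Local Notation bnd := (bnd G).
Hypothesis ht : forall v, col E (nbr v) t.
Hypothesis hK : forall s, pairwise E s -> size s < K.

Fixpoint local_levelM (g : nat -> nat) f :=
  if f is f'.+1 then levelM t (g (2 * local_levelM g f')) else outerM t (K + K).

(** If a level is not local, some interval contains a large set whose hairs all lie beyond one end
    of it: a further outer support, on the left or, after reversal, on the right. After [K + K]
    failures one side would give a clique of size at least [K]. As the constant [c] is known only at
    the end, the size required is a function [g] of it. *)
Lemma local_level_aux g f (D : {set V}) zsL zsR : size zsL + size zsR + f = K + K ->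
  outer G D zsL -> outer (rev_graph G) D zsR -> big E D (local_levelM g f) ->
  exists (p : V) (z : {ffun V -> V}) (X : {set V}) (c : nat),
    [/\ X \subset D, level G p z X, forall x, x \in X -> z x \in D, loc G c z X & big E X (g c)].
Proof.
elim: f D zsL zsR => [|f IH] D zsL zsR sz oL oR /= bD.
  have : (K <= size zsL) || (K <= size zsR) by lia.
  case/orP=> kz.
    have [||s [ss /hK]] := @outer_clique _ G t (size zsL) D zsL ht _ oL _ => //.
      by apply: big_leq bD; apply: outerM_mono; lia.
    by nlia.
  have [||s [ss /hK]] := @outer_clique _ (rev_graph G) t (size zsR) D zsR ht _ oR _ => //.
    by apply: big_leq bD; apply: outerM_mono; lia.
  by nlia.
have [p [z [X [sXD lX zD bX]]]] := level_ex ht bD.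
case: (EM (loc G (2 * local_levelM g f) z X)) => [lc|nlc]; first by exists p, z, X, (2 * local_levelM g f).
have [i [j bij]] : exists i j, big E [set x in X :&: itv i j | z x \notin itv i j] (2 * local_levelM g f).
  apply: contrapT => noij; apply: nlc => i j.
  case: (col_big E [set x in X :&: itv i j | z x \notin itv i j] (2 * local_levelM g f)) => // b.
  by case: noij; exists i, j.
rewrite mul2n -addnn in bij.
have [b|b] : big E [set x in X :&: itv i j | pos (z x) < i] (local_levelM g f) \/
    big E [set x in X :&: itv i j | j <= pos (z x)] (local_levelM g f).
- apply: big_cover bij; apply/subsetP=> x; rewrite !inE => /andP[/andP[-> ->] /=]; nlia.
- have sX1 : [set x in X :&: itv i j | pos (z x) < i] \subset X.
    by apply/subsetP=> x; rewrite !inE => /andP[/andP[]].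
  have [|||q [z' [X' [c [sX' l' zD' lc' b']]]]] := IH _ (z :: zsL) zsR _ _ _ b.
  + by rewrite /= -sz; lia.
  + apply: (outer_cons (i := i)) oL sXD sX1 lX zD _ => x.
    by rewrite !inE => /andP[/andP[_ /andP[h _]] ->].
  + exact: outer_sub (subset_trans sX1 sXD) oR.
  exists q, z', X', c; split=> //.
    exact: subset_trans sX' (subset_trans sX1 sXD).
  by move=> x /zD' /(subsetP sX1) /(subsetP sXD).
- have sX1 : [set x in X :&: itv i j | j <= pos (z x)] \subset X.
    by apply/subsetP=> x; rewrite !inE => /andP[/andP[]].
  have [|||q [z' [X' [c [sX' l' zD' lc' b']]]]] := IH _ zsL (z :: zsR) _ _ _ b.
  + by rewrite /= -sz; lia.
  + exact: outer_sub (subset_trans sX1 sXD) oL.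
  + have lXr : level (rev_graph G) p z X.
      case: lX => h1 h2 h3; split=> //=; case: h3 => h3; [right|left] => x /h3;
      by have := pos_bnd G x; have := pos_bnd G p; nlia.
    apply: (outer_cons (i := (bnd).+1 - j)) oR sXD sX1 lXr zD _ => x.
    rewrite !inE /= => /andP[/andP[_ /andP[_ h]] h'].
    by have := pos_bnd G x; have := pos_bnd G (z x); nlia.
  exists q, z', X', c; split=> //.
    exact: subset_trans sX' (subset_trans sX1 sXD).
  by move=> x /zD' /(subsetP sX1) /(subsetP sXD).
Qed.

Lemma local_level g (D : {set V}) : big E D (local_levelM g (K + K)) ->
  exists (p : V) (z : {ffun V -> V}) (X : {set V}) (c : nat),
    [/\ X \subset D, level G p z X, forall x, x \in X -> z x \in D, loc G c z X & big E X (g c)].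
Proof. by apply: (@local_level_aux g (K + K) D [::] [::]); split. Qed.

Local Notation lvl := (V * {ffun V -> V} * {set V})%type.

(* The oldest level comes first. *)
Definition levels (c : nat) (D : {set V}) (lv : seq lvl) : Prop :=
  (forall l, l \in lv -> [/\ D \subset l.2, level G l.1.1 l.1.2 l.2 & loc G c l.1.2 l.2]) /\
  pairwise (fun l l' : lvl => [forall x in l'.2, l'.1.2 x \in l.2]) lv.

Lemma levels_sub c (D D' : {set V}) lv lv' : D' \subset D -> subseq lv' lv ->
  levels c D lv -> levels c D' lv'.
Proof.
move=> sD sl [h1 h2]; split; last exact: subseq_pairwise h2.
by move=> l /(mem_subseq sl) /h1 [s l' c']; split=> //; apply: subset_trans s.
Qed.

Fixpoint levelsM n (h : nat -> nat) :=
  if n is n'.+1 then local_levelM (fun c => levelsM n' (fun c' => h (maxn c c'))) (K + K) else h 0.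

Lemma local_levels n h (D : {set V}) : big E D (levelsM n h) ->
  exists (lv : seq lvl) c (X : {set V}), [/\ size lv = n, X \subset D, levels c X lv,
    forall l, l \in lv -> forall x, x \in l.2 -> l.1.2 x \in D & big E X (h c)].
Proof.
elim: n h D => [|n IH] h D /= bD; first by exists [::], 0, D; split.
have [p [z [X1 [c [sX1 lX1 zD lc bX1]]]]] := local_level bD.
have [lv [c' [X [sz sX [l1 l2] zX bX]]]] := IH _ _ bX1.
exists ((p, z, X1) :: lv), (maxn c c'), X; split=> //=.
- by rewrite sz.
- exact: subset_trans sX sX1.
- split=> [l|/=].
    rewrite inE => /orP[/eqP->|/l1 [s a b]]; split=> //=.
      by apply: loc_leq lc; lia.
    by apply: loc_leq b; lia.
  by rewrite l2 andbT; apply/allP=> l /zX h'; apply/forall_inP.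
- move=> l; rewrite inE => /orP[/eqP->|/zX h'] //= x /h'.
  exact: (subsetP sX1).
Qed.

(** * Dominating ends of edges *)

(* [u] is adjacent to all hairs to its right that lie before the last, [b]-colourable, part of [Y]. *)
Definition domR b (z : {ffun V -> V}) (X : {set V}) u (Y : {set V}) : Prop :=
  forall c, big E (Y :&: itv c bnd) b ->
  forall x, x \in X -> pos u < pos (z x) < c -> E u (z x).

Definition domL b (z : {ffun V -> V}) (X : {set V}) v (Y : {set V}) : Prop :=
  forall c, big E (Y :&: itv 0 c) b ->
  forall x, x \in X -> c <= pos (z x) < pos v -> E v (z x).

(** The product [b * y] lets the refinement be iterated over several supports, at the cost of a
    power of [b]. *)
Definition dom b (z : {ffun V -> V}) (X : {set V}) : Prop :=
  forall u v (Y : {set V}) y, u \in X -> v \in X -> E u v -> pos u < pos v ->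
    Y \subset X :&: itv (pos u).+1 (pos v) -> (forall x, x \in Y -> ~~ E u x /\ ~~ E v x) ->
    big E Y (b * y) ->
  exists Y' : {set V}, [/\ Y' \subset Y, big E Y' y & domR b z X u Y' \/ domL b z X v Y'].

Lemma domR_mono b b' z X u (Y Y' : {set V}) : b <= b' -> Y' \subset Y ->
  domR b z X u Y -> domR b' z X u Y'.
Proof.
move=> bb sY h c bc; apply: h; apply: big_leq bb _.
by apply: big_sub bc; apply: setSI.
Qed.

Lemma domL_mono b b' z X u (Y Y' : {set V}) : b <= b' -> Y' \subset Y ->
  domL b z X u Y -> domL b' z X u Y'.
Proof.
move=> bb sY h c bc; apply: h; apply: big_leq bb _.
by apply: big_sub bc; apply: setSI.
Qed.

Lemma dom_leq b b' z X : b <= b' -> dom b z X -> dom b' z X.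
Proof.
move=> bb h u v Y y uX vX uv lt sY NY bY.
have [|Y' [sY' bY' d]] := h u v Y y uX vX uv lt sY NY; first by apply: big_leq bY; nia.
exists Y'; split=> //; case: d => d; [left|right].
  by apply: domR_mono d.
by apply: domL_mono d.
Qed.

Lemma big_avoid_all (I : eqType) (s : seq I) (F : I -> {set V}) (A : {set V}) m n :
  (forall i, i \in s -> col E (F i) m) -> big E A (n + m * size s) ->
  big E [set x in A | all (fun i => x \notin F i) s] n.
Proof.
elim: s A => [|i s IH] A cF /=.
  by rewrite muln0 addn0; apply: big_sub; apply/subsetP=> x; rewrite inE => ->.
rewrite mulnS addnCA addnC => /(bigD (cF i (mem_head _ _))) bA.
apply: big_sub (IH _ _ bA); first by apply/subsetP=> x; rewrite !inE => /andP[/andP[-> ->] ->].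
by move=> j js; apply: cF; rewrite inE js orbT.
Qed.

Section Batch.
Variables (F : nat -> nat) (c : nat).

Fixpoint batch_size k := if k is k'.+1 then (batch_size k' + batch_size k').+1 else 0.

(** The terms give [c <= b], room for the recursion after vertices with far hairs are deleted, and
    room for the patterns of adjacency to [u]. *)
Definition batch_bound k m := maxn c (maxn (m + c * batch_size k) (2 ^ (batch_size k + batch_size k))).

Fixpoint batchM k := if k is k'.+1 then F (batch_bound k' (batchM k')) else 0.

(* A hair of [l] missed by [u] is adjacent to all later hairs that [u] meets farther away. *)
Lemma batch_hair (l : lvl) lv (D : {set V}) u x (l' : lvl) y : levels c D (l :: lv) -> u \in D ->
  x \in D -> ~~ E u (l.1.2 x) -> l' \in lv -> y \in D -> E u (l'.1.2 y) ->
  pos u < pos (l.1.2 x) < pos (l'.1.2 y) \/ pos (l'.1.2 y) < pos (l.1.2 x) < pos u ->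
  E (l.1.2 x) (l'.1.2 y).
Proof.
move=> [h1 /= /andP[/allP h2 _]] uD xD Nus l'in yD Euy lt.
have [/subsetP sD ll _] := h1 _ (mem_head _ _).
have [/subsetP sD' _ _] : [/\ D \subset l'.2, level G l'.1.1 l'.1.2 l'.2 & loc G c l'.1.2 l'.2].
  by apply: h1; rewrite inE l'in orbT.
have yl : l'.1.2 y \in l.2 by have /forall_inP := h2 _ l'in; apply; apply: sD'.
case: lt => lt.
  have := level_hair ll (sD _ xD) (sD _ uD) yl Euy lt.
  by rewrite (negbTE Nus) adj_sym.
rewrite adj_sym in Euy.
have := level_hair ll (sD _ xD) yl (sD _ uD) Euy lt.
by rewrite (negbTE Nus) orbF adj_sym.
Qed.

Definition batch_concl k (D : {set V}) (lv : seq lvl) : Prop :=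
  (exists s : seq V, [/\ size s = k, pairwise E s &
     forall v, v \in s -> exists2 l : lvl, l \in lv & exists2 y, y \in D & v = l.1.2 y]) \/
  (exists (X : {set V}) (l : lvl) b, [/\ X \subset D, l \in lv, c <= b, big E X (F b) &
     dom b l.1.2 X]).

Lemma batch_step k (l : lvl) lv lv' (D D' : {set V}) w x : levels c D (l :: lv) ->
  subseq lv' lv -> D' \subset D -> x \in D ->
  (forall (l' : lvl) y, l' \in lv' -> y \in D' -> E (l.1.2 x) (l'.1.2 y)) ->
  w = k.+1 -> batch_concl k D' lv' -> batch_concl w D (l :: lv).
Proof.
move=> lD sl sD xD adjs -> [[s [ss ps hs]]|[X [l' [b [sX l'in cb bX dX]]]]].
  left; exists (l.1.2 x :: s); split=> /=; first by rewrite ss.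
    rewrite ps andbT; apply/allP=> v /hs [l' l'in [y yD ->]]; exact: adjs.
  move=> v; rewrite inE => /orP[/eqP->|/hs [l' l'in [y yD ->]]].
    by exists l; [exact: mem_head|exists x].
  exists l'; first by rewrite inE (mem_subseq sl l'in) orbT.
  by exists y => //; apply: (subsetP sD).
right; exists X, l', b; split=> //; first exact: subset_trans sX sD.
by rewrite inE (mem_subseq sl l'in) orbT.
Qed.

(** Either the oldest level satisfies [dom], or one of its hairs is adjacent to all hairs of
    [batch_size k] later levels over a large set, where induction applies. *)
Lemma batch k (D : {set V}) lv : size lv = batch_size k -> levels c D lv -> big E D (batchM k) ->
  batch_concl k D lv.
Proof.
elim: k D lv => [|k IH] D [|l lv] //=; first by left; exists [::].
move=> [sz] lD bD; set b := batch_bound k (batchM k) in bD.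
case: (EM (batch_concl k.+1 D (l :: lv))) => // nog; right; exists D, l, b.
have bc : c <= b by rewrite /b /batch_bound; lia.
have bM : batchM k + c * batch_size k <= b by rewrite /b /batch_bound; lia.
have b2 : 2 ^ (batch_size k + batch_size k) <= b by rewrite /b /batch_bound; lia.
split=> //; first exact: mem_head.
move=> u v Y y uD vD uv lt_uv sY NY bY.
have YP x : x \in Y -> x \in D /\ pos u < pos x < pos v.
  by move/(subsetP sY); rewrite !inE => /andP[].
have [lD1 _] := lD.
have lP l' : l' \in lv -> [/\ D \subset l'.2, level G l'.1.1 l'.1.2 l'.2 & loc G c l'.1.2 l'.2].
  by move=> h; apply: lD1; rewrite inE h orbT.
(* Adjacency of [u] to the hairs of each later level is made uniform; where [u] meets none of them,
   [level_cross] makes [v] meet all. *)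
have [Y' [sY' bY' cY']] : exists Y' : {set V}, [/\ Y' \subset Y, big E Y' y &
    forall l', l' \in lv -> (forall x, x \in Y' -> E u (l'.1.2 x)) \/
                          (forall x, x \in Y' -> ~~ E u (l'.1.2 x))].
  apply: big_pattern (fun (l' : lvl) x => E u (l'.1.2 x)) _ _ _.
  by apply: big_leq bY; rewrite sz; nia.
have Y'D : Y' \subset D by apply/subsetP=> x /(subsetP sY') /YP [].
pose lu := [seq l' : lvl <- lv | [forall x in Y', E u (l'.1.2 x)]].
pose lw := [seq l' : lvl <- lv | ~~ [forall x in Y', E u (l'.1.2 x)]].
have luP (l' : lvl) x : l' \in lu -> x \in Y' -> l' \in lv /\ E u (l'.1.2 x).
  by rewrite mem_filter => /andP[/forall_inP h ->] /h.
have lwP (l' : lvl) x : l' \in lw -> x \in Y' -> l' \in lv /\ E v (l'.1.2 x).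
  rewrite mem_filter => /andP[/forall_inP h l'in] xY; split=> //.
  have [//|h'] := cY' _ l'in.
  have [/subsetP sD ll _] := lP _ l'in.
  have xY2 := subsetP sY' _ xY; have [xD xuv] := YP _ xY2; have [Nux Nvx] := NY _ xY2.
  have := level_cross ll (sD _ xD) (sD _ uD) (sD _ vD) uv xuv Nux Nvx.
  by rewrite (negbTE (h' _ xY)).
(* A missed hair of [l] between [w] and a large interval is impossible: once the vertices with hairs
   outside the interval are deleted, [batch_hair] joins it to all hairs of [lt], and the induction
   hypothesis contradicts [nog]. *)
have fin (w : V) ls i j x : subseq ls lv -> batch_size k <= size ls -> w \in D -> x \in D ->
    (forall (l' : lvl) y, l' \in ls -> y \in Y' -> E w (l'.1.2 y)) -> ~~ E w (l.1.2 x) ->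
    big E (Y' :&: itv i j) b ->
    (forall q, i <= q < j -> pos w < pos (l.1.2 x) < q \/ q < pos (l.1.2 x) < pos w) -> False.
  move=> sls szs wD xD adjw Nw bij ord; apply: nog.
  set lt := take (batch_size k) ls.
  have slt : subseq lt lv by apply: subseq_trans (take_subseq _ _) sls.
  have szt : size lt = batch_size k by rewrite size_takel.
  pose bad (l' : lvl) := [set y in l'.2 :&: itv i j | l'.1.2 y \notin itv i j].
  have bD' : big E [set y in Y' :&: itv i j | all (fun l' => y \notin bad l') lt] (batchM k).
    apply: (@big_avoid_all _ lt bad _ c); last by rewrite szt; apply: big_leq bij.
    by move=> l' /(mem_subseq slt) /lP [_ _ lc]; apply: lc.
  set D' := [set y in _ | _] in bD'.
  have D'Y y1 : y1 \in D' -> y1 \in Y' /\ i <= pos y1 < j.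
    by move=> /setIdP[/setIP[? +] _]; rewrite inE.
  have sD' : D' \subset D.
    by apply/subsetP=> y1 /D'Y [h _]; apply: (subsetP Y'D).
  apply: (batch_step lD slt sD' xD _ (erefl _)); last first.
    by apply: IH => //; apply: levels_sub sD' _ lD; apply: subseq_trans slt (subseq_cons _ _).
  move=> l' y1 l'in yD'; have [yY yij] := D'Y _ yD'.
  apply: (batch_hair lD wD xD Nw (mem_subseq slt l'in) (subsetP sD' _ yD')).
    by apply: adjw => //; apply: mem_subseq (take_subseq _ _) _ l'in.
  apply: ord; have /setIdP[_ /allP/(_ _ l'in)] := yD'.
  have [/subsetP sDl _ _] := lP _ (mem_subseq slt l'in).
  by rewrite !inE sDl ?(subsetP sD') //= yij negbK.
exists Y'; split=> //.
have : size lu + size lw = batch_size k + batch_size k by rewrite -sz !size_filter count_predC.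
have [szu _|szu szw] := leqP (batch_size k) (size lu); [left|right].
  move=> e be x xD hx; apply/negPn/negP=> Nx.
  apply: (fin u lu e bnd x (filter_subseq _ _) szu uD xD _ Nx be) => [l' y1 l'in yY|q qe].
    by have [] := luP _ _ l'in yY.
  by left; nlia.
have szw' : batch_size k <= size lw by lia.
move=> e be x xD hx; apply/negPn/negP=> Nx.
apply: (fin v lw 0 e x (filter_subseq _ _) szw' vD xD _ Nx be) => [l' y1 l'in yY|q qe].
  by have [] := lwP _ _ l'in yY.
by right; nlia.
Qed.

End Batch.

Definition domM (F : nat -> nat) := levelsM (batch_size K) (fun c => batchM F c K).

Lemma dom_support (F : nat -> nat) (D : {set V}) : big E D (domM F) ->
  exists (z : {ffun V -> V}) (X : {set V}) b, [/\ X \subset D, forall x, x \in X -> z x \in D,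
    loc G b z X, dom b z X & big E X (F b)].
Proof.
move=> bD; have [lv [c [D1 [sz sD1 lD1 zD bD1]]]] := local_levels bD.
have [[s [ss /hK]]|] := batch sz lD1 bD1; first by rewrite ss; lia.
case=> X [l [b [sX lin cb bX dX]]]; exists l.1.2, X, b.
have [/(_ _ lin) [sl _ lc] _] := lD1.
have sXl := subset_trans sX sl.
split=> //; first exact: subset_trans sX sD1.
  by move=> x /(subsetP sXl); apply: zD.
apply: loc_leq cb _ => i j; apply: col_sub (lc i j); apply/subsetP=> x.
by rewrite !inE => /andP[/andP[/(subsetP sXl) -> ->] ->].
Qed.

End Batches.

(** * Chains of supports *)

Section Chains.
Context {V : finType} (G : ograph V) (K : nat).
Local Notation E := (adj G).
Local Notation pos := (pos G).
Local Notation itv := (itv G).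
Local Notation grp := ({ffun V -> V} * {set V})%type.

(* Some interval starting just after [w] meets [W] in a set of large chromatic number, and all hairs
   of the selected supports in that interval are adjacent to [w]. *)
Definition complR n (W : {set V}) w (gs : seq grp) (A : pred grp) : Prop :=
  exists c, big E (W :&: itv (pos w).+1 c) n /\
    forall g, g \in gs -> A g -> forall x, x \in g.2 -> pos w < pos (g.1 x) < c -> E w (g.1 x).

Definition complL n (W : {set V}) w (gs : seq grp) (A : pred grp) : Prop :=
  exists c, big E (W :&: itv c (pos w)) n /\
    forall g, g \in gs -> A g -> forall x, x \in g.2 -> c <= pos (g.1 x) < pos w -> E w (g.1 x).

(* The most recent support comes first. *)
Fixpoint chain (gs : seq grp) : Prop :=
  if gs is g :: gs' then
    (exists c (W : {set V}), (forall h, h \in gs' -> loc G c h.1 h.2 /\ W \subset h.2) /\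
       forall x, x \in g.2 -> complR (K * c.+1) W (g.1 x) gs' xpredT) /\
    chain gs'
  else True.

(** Locality of the newest support yields a hair [w] in the left part of the interval; the other
    hairs are sought to the right of [w], where [w] is still complete to them. *)
Lemma chain_clique (gs : seq grp) c (Y : {set V}) i j : size gs <= K -> chain gs ->
  (forall h, h \in gs -> loc G c h.1 h.2 /\ Y \subset h.2) ->
  big E (Y :&: itv i j) (size gs * c.+1) ->
  exists s : seq V, [/\ size s = size gs, pairwise E s &
    forall v, v \in s -> i <= pos v < j /\
      exists2 g : grp, g \in gs & exists2 x, x \in g.2 & v = g.1 x].
Proof.
elim: gs c Y i j => [|g gs IH] c Y i j /=; first by exists [::].
move=> szK [[c' [W [hW complg]] chg] hY bY].
have [e [b1 b2]] : exists e, big E (Y :&: itv i j :&: itv 0 e) c /\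
    big E (Y :&: itv i j :&: itv e (bnd G)) (size gs * c.+1).
  by apply: big_cut; apply: big_leq bY; lia.
have [lg sYg] := hY _ (mem_head _ _).
have hY' h : h \in gs -> loc G c h.1 h.2 /\ Y \subset h.2.
  by move=> hin; apply: hY; rewrite inE hin orbT.
have [x xY xe] : exists2 x, x \in Y :&: itv i j :&: itv 0 e & i <= pos (g.1 x) < minn e j.
  apply: contrapT => nox; apply: b1; apply: col_sub (lg i (minn e j)); apply/subsetP=> x xin.
  have : ~~ (i <= pos (g.1 x) < minn e j) by apply/negP=> h; apply: nox; exists x.
  move: xin; rewrite !inE => /andP[/andP[xY xij] xe] ->; rewrite (subsetP sYg _ xY) /= andbT.
  by nlia.
have xg : x \in g.2 by move: xY; rewrite !inE => /andP[/andP[/(subsetP sYg)]].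
have [c0 [bc0 adj0]] := complg _ xg; set w := g.1 x in xe bc0 adj0 *.
have wrap s i' j' : [/\ size s = size gs, pairwise E s & forall v, v \in s -> i' <= pos v < j' /\
      exists2 g : grp, g \in gs & exists2 x, x \in g.2 & v = g.1 x] ->
    pos w < i' -> j' <= c0 -> j' <= j -> exists s : seq V, [/\ size s = (size gs).+1, pairwise E s &
    forall v, v \in s -> i <= pos v < j /\
      exists2 g0 : grp, g0 \in g :: gs & exists2 x, x \in g0.2 & v = g0.1 x].
  move=> [ss ps hs] wi jc jj; exists (w :: s); split=> /=; first by rewrite ss.
    rewrite ps andbT; apply/allP=> v /hs [vij [h hin [y yh vE]]].
    by rewrite vE; apply: adj0 => //; rewrite -vE; nlia.
  move=> v; rewrite inE => /orP[/eqP->|/hs [vij [h hin [y yh vE]]]].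
    by split; [nlia|exists g; [exact: mem_head|exists x]].
  by split; [nlia|exists h; [rewrite inE hin orbT|exists y]].
(* If the old interval ends first, its right part is still large; otherwise the set [W] attached to
   [g] takes over, with its own constant [c']. *)
case: (leqP j c0) => jc.
  have [|s hs] := IH c Y (pos w).+1 j (ltnW szK) chg hY'.
    by apply: big_sub b2; apply/subsetP=> y; rewrite !inE; case: (y \in Y) => //=; nlia.
  by apply: (wrap _ _ _ hs).
have [|s hs] := IH c' W (pos w).+1 c0 (ltnW szK) chg hW; first by apply: big_leq bc0; nia.
by apply: (wrap _ _ _ hs) => //; nlia.
Qed.

End Chains.

(** * Towers of supports and Ramsey's theorem *)

Section Towers.
Context {V : finType} (G : ograph V) (t K : nat).
Local Notation E := (adj G).
Local Notation pos := (pos G).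
Local Notation itv := (itv G).
Local Notation nbr := (nbr G).
Local Notation bnd := (bnd G).
Local Notation grp := ({ffun V -> V} * {set V})%type.
Hypothesis ht : forall v, col E (nbr v) t.
Hypothesis hK : forall s, pairwise E s -> size s < K.

Lemma loc_rev c z X : loc G c z X -> loc (rev_graph G) c z X.
Proof. by move=> lX i j; rewrite rev_itv; apply: lX. Qed.

Lemma complL_rev n W w gs A : complL G n W w gs A -> complR (rev_graph G) n W w gs A.
Proof.
move=> [c [bc hc]]; exists (bnd.+1 - c).
have [x] := big_ex bc; rewrite !inE => /andP[_ xc].
have pw := pos_bnd G w; have px := pos_bnd G x.
split.
  have E1 : bnd.+1 - (bnd.+1 - c) = c by nlia.
  have E2 : bnd.+1 - (bnd - pos w).+1 = pos w by nlia.
  by rewrite rev_itv /= E1 E2.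
move=> g gin Ag y yg /= h; apply: hc => //.
move: h (pos_bnd G (g.1 y)) pw; move: (pos (g.1 y)) (pos w) bnd => p q N /=; clear; lia.
Qed.

(** One refinement per support; earlier choices survive because [domR] and [domL] pass to subsets.
    [A] collects the supports dominated from [u]. *)
Lemma dom_refine b (gs : seq grp) u v (Y : {set V}) y : E u v -> pos u < pos v ->
  (forall x, x \in Y -> ~~ E u x /\ ~~ E v x) ->
  (forall g, g \in gs -> [/\ u \in g.2, v \in g.2, Y \subset g.2 :&: itv (pos u).+1 (pos v) &
     dom G b g.1 g.2]) ->
  big E Y (b ^ size gs * y) ->
  exists (Y' : {set V}) (A : pred grp), [/\ Y' \subset Y, big E Y' y &
    forall g, g \in gs -> (A g -> domR G b g.1 g.2 u Y') /\ (~~ A g -> domL G b g.1 g.2 v Y')].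
Proof.
move=> uv lt; elim: gs Y => [|g gs IH] Y NY hY /=.
  by rewrite expn0 mul1n => bY; exists Y, xpredT; split.
rewrite expnS -mulnA => bY.
have [ug vg sY dg] := hY _ (mem_head _ _).
have [Y1 [sY1 bY1 d1]] := dg _ _ _ _ ug vg uv lt sY NY bY.
have [||Y' [A [sY' bY' hA]]] := IH Y1 _ _ bY1.
- by move=> x /(subsetP sY1) /NY.
- move=> h hin; have [|uh vh sh dh] := hY h; first by rewrite inE hin orbT.
  by split=> //; apply: subset_trans sY1 sh.
exists Y', (fun h => if h == g then `[< domR G b g.1 g.2 u Y1 >] else A h); split=> //.
  exact: subset_trans sY' sY1.
move=> h; rewrite inE; case: eqP => [->|_] /=; last exact: hA.
move=> _; split=> [/asboolP|/asboolPn] d; first by apply: domR_mono d.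
by case: d1 => // d1; apply: domL_mono d1.
Qed.

Definition tower_stageM r b n m :=
  2 ^ (2 ^ r) * (2 ^ (2 ^ r) * maxn m (2 * (b ^ r * (n + b + 1) + (t + t)).+1)).

(** The set is first made uniform for [complR] and [complL] over all [2 ^ r] subfamilies. The ends
    of a single deep edge then determine [A], and uniformity transfers their properties to every
    vertex of [W]. *)
Lemma tower_stage b n m (gs : seq grp) (W0 : {set V}) :
  (forall g, g \in gs -> W0 \subset g.2 /\ dom G b g.1 g.2) ->
  big E W0 (tower_stageM (size gs) b n m) ->
  exists (W : {set V}) (A : pred grp), [/\ W \subset W0, big E W m &
    forall w, w \in W -> complR G n W0 w gs A /\ complL G n W0 w gs (predC A)].
Proof.
set r := size gs => hg bW0.
pose a (q : r.-tuple bool) : pred grp := fun g => g \in mask q gs.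
have cm : size (enum {: r.-tuple bool}) = 2 ^ r by rewrite -cardE card_tuple card_bool.
rewrite /tower_stageM -cm in bW0.
have [W1 [sW1 bW1 h1]] := big_pattern (fun q w => `[< complR G n W0 w gs (a q) >]) bW0.
have [W2 [sW2 bW2 h2]] := big_pattern (fun q w => `[< complL G n W0 w gs (predC (a q)) >]) bW1.
have sW20 := subset_trans sW2 sW1.
have [|u [v [uW vW uv lt bY]]] := @deep_edge _ G W2 (b ^ r * (n + b + 1) + (t + t)).
  by apply: big_leq bW2; lia.
have bY2 : big E ((W2 :&: itv (pos u).+1 (pos v) :\: nbr u) :\: nbr v) (b ^ r * (n + b + 1)).
  by apply: bigD (ht v) _; apply: bigD (ht u) _; rewrite -addnA.
set Y := _ :\: nbr v in bY2.
have YP x : x \in Y -> [/\ x \in W2, pos u < pos x < pos v, ~~ E u x & ~~ E v x].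
  by rewrite !inE => /and3P[-> -> /andP[-> ->]].
have [||Y' [A [sY' bY' hA]]] := dom_refine uv lt _ _ bY2.
- by move=> x /YP [].
- move=> g gin; have [/subsetP sg dg] := hg _ gin.
  split=> //; [exact/sg/(subsetP sW20)|exact/sg/(subsetP sW20)|].
  by apply/subsetP=> x /YP [xW xuv _ _]; rewrite in_setI in_itv xuv sg // (subsetP sW20).
have Y'P x : x \in Y' -> x \in W0 /\ pos u < pos x < pos v.
  by move/(subsetP sY')=> /YP [/(subsetP sW20)].
have szA : size (map A gs) == r by rewrite size_map.
pose q : r.-tuple bool := Tuple szA.
have aE g : g \in gs -> a q g = A g.
  by move=> gin; rewrite /a /= -filter_mask mem_filter gin andbT.
have qin : q \in enum {: r.-tuple bool} by rewrite mem_enum.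
(* The cut leaves a last part that is not [b]-colourable, as [domR] demands, and a large first part
   for [complR]. *)
have complu : complR G n W0 u gs (a q).
  have [e [be1 be2]] := big_cut bY'.
  exists e; split.
    apply: big_sub be1; apply/subsetP=> x; rewrite inE => /andP[/Y'P [xW xuv]].
    by rewrite !inE xW /=; nlia.
  by move=> g gin; rewrite aE // => Ag; have [/(_ Ag) d _] := hA _ gin; apply: d.
have complv : complL G n W0 v gs (predC (a q)).
  have [|e [be1 be2]] := @big_cut _ G Y' b n; first by rewrite (addnC b).
  exists e; split.
    apply: big_sub be2; apply/subsetP=> x; rewrite inE => /andP[/Y'P [xW xuv]].
    by rewrite !inE xW /=; nlia.
  by move=> g gin /=; rewrite aE // => Ag; have [_ /(_ Ag) d] := hA _ gin; apply: d.
exists W2, (a q); split=> //; first by apply: big_leq bW2; lia.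
move=> w wW; split.
  have [h|h] := h1 _ qin; first by apply/asboolP; apply: h; apply: (subsetP sW2).
  by have := h _ (subsetP sW2 _ uW); rewrite asboolT.
have [h|h] := h2 _ qin; first by apply/asboolP; apply: h.
by have := h _ vW; rewrite asboolT.
Qed.

(** A [chain] before the sides are made constant: [A] records the side for each older support. *)
Fixpoint tower (gs : seq grp) : Prop :=
  if gs is g :: gs' then
    (exists c (W : {set V}) (A : pred grp),
       (forall h, h \in gs' -> loc G c h.1 h.2 /\ W \subset h.2) /\
       forall x, x \in g.2 ->
         complR G (K * c.+1) W (g.1 x) gs' A /\ complL G (K * c.+1) W (g.1 x) gs' (predC A)) /\
    tower gs'
  else True.

Lemma tower_filter (a : pred grp) gs : tower gs -> tower (filter a gs).
Proof.
elim: gs => //= g gs IH [[c [W [A [h1 h2]]]] /IH tgs].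
case: ifP => _ //=; split=> //; exists c, W, A; split.
  by move=> h; rewrite mem_filter => /andP[_ /h1].
move=> x /h2 [[e [be he]] [e' [be' he']]].
split; [exists e|exists e']; split=> // h; rewrite mem_filter => /andP[_ hin].
  exact: he.
exact: he'.
Qed.

Fixpoint towerM r (F : nat -> nat) :=
  if r is r'.+1 then
    towerM r' (fun c => tower_stageM r' c (K * c.+1) (domM t K (fun b => F (maxn c b))))
  else F 0.

(** Each new support is found inside the set [W] of a stage, hairs included, so its hairs inherit
    the completeness of the vertices of [W]. *)
Lemma tower_ex r (F : nat -> nat) : big E [set: V] (towerM r F) ->
  exists (gs : seq grp) (W : {set V}) c, [/\ size gs = r, tower gs,
    forall g, g \in gs -> [/\ W \subset g.2, loc G c g.1 g.2 & dom G c g.1 g.2] & big E W (F c)].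
Proof.
elim: r F => [|r IH] F /=; first by exists [::], setT, 0; split.
move=> /IH [gs [W0 [c [sz tgs hgs bW0]]]].
rewrite -sz in bW0.
have [|W [A [sW bW hW]]] := tower_stage _ bW0; first by move=> g /hgs [].
have [z [X [b [sX zX lX dX bX]]]] := dom_support ht hK bW.
exists ((z, X) :: gs), X, (maxn c b); split=> //=.
- by rewrite sz.
- split=> //; exists c, W0, A; split; first by move=> h /hgs [].
  by move=> x /zX /hW.
- move=> g; rewrite inE => /orP[/eqP->|/hgs [s l d]] /=.
    by split=> //; [apply: loc_leq lX|apply: dom_leq dX]; lia.
  split; [exact: subset_trans sX (subset_trans sW s)|apply: loc_leq l|apply: dom_leq d]; lia.
Qed.

(** Two-colour Ramsey: the newest support splits the older ones by side, and induction continues in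
    a part of size at least [2 ^ n]. Left sides become right sides in the reversed graph. *)
Lemma ramsey_chain n a b (gs : seq grp) : a + b = n -> 2 ^ n <= size gs -> tower gs ->
  (exists s : seq grp, [/\ size s = a, {subset s <= gs} & chain G K s]) \/
  (exists s : seq grp, [/\ size s = b, {subset s <= gs} & chain (rev_graph G) K s]).
Proof.
elim: n a b gs => [|n IH] [|a] [|b] gs //=; try by [left; exists [::]|right; exists [::]].
move=> abn; case: gs => [|g gs]; first by rewrite /= leqNgt expn_gt0.
move=> szg [[c [W [A [h1 h2]]]] tgs].
have szA : size (filter A gs) + size (filter (predC A) gs) = size gs.
  by rewrite !size_filter count_predC.
rewrite expnS /= in szg.
have [sA|sA] : 2 ^ n <= size (filter A gs) \/ 2 ^ n <= size (filter (predC A) gs) by lia.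
  have [|[s [sz ss ch]]|[s [sz ss ch]]] := IH a b.+1 (filter A gs) _ sA (tower_filter _ tgs).
  - by lia.
  - left; exists (g :: s); split=> /=; first by rewrite sz.
      move=> h; rewrite !inE => /orP[->//|/ss]; rewrite mem_filter => /andP[_ ->].
      by rewrite orbT.
    split=> //; exists c, W; split.
      by move=> h /ss; rewrite mem_filter => /andP[_ /h1].
    move=> x /h2 [[e [be he]] _]; exists e; split=> // h /ss.
    by rewrite mem_filter => /andP[Ah hin] _; apply: he.
  - right; exists s; split=> // h /ss; rewrite mem_filter => /andP[_ hin].
    by rewrite inE hin orbT.
have [|[s [sz ss ch]]|[s [sz ss ch]]] := IH a.+1 b (filter (predC A) gs) _ sA (tower_filter _ tgs).
- by lia.
- left; exists s; split=> // h /ss; rewrite mem_filter => /andP[_ hin].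
  by rewrite inE hin orbT.
- right; exists (g :: s); split=> /=; first by rewrite sz.
    move=> h; rewrite !inE => /orP[->//|/ss]; rewrite mem_filter => /andP[_ ->].
    by rewrite orbT.
  split=> //; exists c, W; split.
    by move=> h /ss; rewrite mem_filter => /andP[_ /h1 [l s']]; split=> //; apply: loc_rev.
  move=> x /h2 [_ /complL_rev [e [be he]]]; exists e; split=> // h /ss.
  by rewrite mem_filter => /andP[Ah hin] _; apply: he.
Qed.

Lemma bounded_chi : col E [set: V] (towerM (2 ^ (K + K)) (fun c => K * c.+1)).
Proof.
apply: contrapT => bV.
have [gs [W [c [sz tgs hgs bW]]]] := tower_ex bV.
have [||[s [ss sgs ch]]|[s [ss sgs ch]]] := @ramsey_chain (K + K) K K gs _ _ tgs => //.
- by rewrite sz.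
- have [|||q [sq pq _]] := @chain_clique _ G K s c W 0 bnd _ ch _ _.
  + by rewrite ss.
  + by move=> h /sgs /hgs [].
  + rewrite ss; apply: big_sub bW; apply/subsetP=> x xW.
    by rewrite in_setI xW in_itv pos_bnd.
  + by have := hK pq; rewrite sq ss ltnn.
(* Reversed positions may equal [bnd], hence the end [bnd.+1]. *)
- have [|||q [sq pq _]] := @chain_clique _ (rev_graph G) K s c W 0 bnd.+1 _ ch _ _.
  + by rewrite ss.
  + by move=> h /sgs /hgs [? ? _]; split=> //; apply: loc_rev.
  + rewrite ss; apply: big_sub bW; apply/subsetP=> x xW.
    by rewrite in_setI xW in_itv /= ltnS leq_subr.
  + by have := hK pq; rewrite sq ss ltnn.
Qed.

End Towers.

(** * From cliques to the chromatic number *)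

Section Restriction.
Context {V : finType} (G : ograph V) (A : {set V}).
Local Notation sV := {x : V | x \in A}.

Definition sub_graph : ograph sV.
Proof.
apply: (@OGraph _ (fun x : sV => pos G (val x)) (fun x y : sV => adj G (val x) (val y))).
- by move=> x y /pos_inj/val_inj.
- by move=> x y; apply: adj_sym.
- by move=> x; apply: adj_irr.
- by move=> a b c d; apply: adj_cross.
Defined.

Lemma col_sub_graph n : col (adj sub_graph) setT n -> col (adj G) A n.
Proof.
move=> [c [c1 c2]]; exists (fun x => oapp c 0 (insub x)); split.
  by move=> x xA; rewrite insubT /= c1.
move=> x y xA yA xy; rewrite (insubT (fun x => x \in A) xA) (insubT (fun x => x \in A) yA) /=.
exact: c2.
Qed.

End Restriction.

(** A clique in the neighbourhood of [v] is extended by [v], so the previous case supplies the bound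
    [t] on neighbourhoods. *)
Lemma ograph_chi_bounded K : exists M, forall (V : finType) (G : ograph V),
  (forall s, pairwise (adj G) s -> size s < K) -> col (adj G) [set: V] M.
Proof.
elim: K => [|K [t IH]]; first by exists 0 => V G /(_ [::] isT).
exists (towerM t K.+1 (2 ^ (K.+1 + K.+1)) (fun c => K.+1 * c.+1)) => V G hK.
apply: bounded_chi => // v; apply: col_sub_graph; apply: IH => s ps.
rewrite -ltnS -(size_map val s); apply: (hK (v :: map val s)).
rewrite /= pairwise_map ps andbT; apply/allP => _ /mapP[x _ ->].
by have := valP x; rewrite in_nbr.
Qed.

(** * From linear orders to positions *)

Section Translation.
Context (T : finType) (lt E : rel T).
Hypotheses (gE : simple_graph E) (olt : strict_linear_order lt) (Xf : X_free lt E).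

Definition rank (x : T) := #|[set y | lt y x]|.

Lemma rank_lt x y : lt x y -> rank x < rank y.
Proof.
case: olt => irr [tr _] xy; apply: proper_card; apply/properP; split.
  by apply/subsetP => z; rewrite !inE => zx; apply: tr xy.
by exists x; rewrite !inE ?irr.
Qed.

Lemma lt_rank x y : (rank x < rank y) = lt x y.
Proof.
apply/idP/idP; last exact: rank_lt.
case: olt => _ [_ tot]; case: (eqVneq x y) => [->|/tot]; first by rewrite ltnn.
by case/orP=> // /rank_lt yx xy; have := ltn_trans xy yx; rewrite ltnn.
Qed.

Lemma rank_inj : injective rank.
Proof.
move=> x y xy; apply/eqP; apply: contraT; case: olt => _ [_ tot] /tot.
by rewrite -!lt_rank xy ltnn.
Qed.

Lemma rank_cross a b c d : rank a < rank b -> rank b < rank c -> rank c < rank d ->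
  E a c -> E b d -> [|| E a b, E b c, E c d | E a d].
Proof.
rewrite !lt_rank => ab bc cd ac bd; apply: contraT; rewrite !negb_or => /and4P[nab nbc ncd nad].
by case: Xf; exists a, b, c, d.
Qed.

Definition ograph_of : ograph T :=
  OGraph rank_inj gE.1 gE.2 rank_cross.

Lemma size_clique s : pairwise E s -> size s <= clique_number E.
Proof.
move=> ps; have us : uniq s.
  apply: pairwise_uniq ps => x; exact: gE.2.
rewrite -(card_uniqP us) -cardsE; apply: leq_bigmax_cond.
apply/forall_inP=> x; rewrite inE => xs; apply/forall_inP=> y; rewrite inE => ys.
apply/implyP=> nxy.
have [sE iE] := gE.
have al : {in s &, forall x y, x != y -> E x y}.
  elim: s ps {us xs ys} => //= z s IH /andP[/allP az /IH ha] u w.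
  rewrite !inE => /orP[/eqP->|us] /orP[/eqP->|ws] nuw; rewrite ?eqxx // in nuw *.
  - exact: az.
  - by rewrite sE az.
  - exact: ha.
exact: al.
Qed.

Lemma chromatic_number_leq n : col E [set: T] n -> chromatic_number E <= n.
Proof.
move=> [c [c1 c2]].
have bmin (I : eqType) (r : seq I) (P : pred I) (F : I -> nat) m i :
    i \in r -> P i -> \big[minn/m]_(j <- r | P j) F j <= F i.
  elim: r => // j r IH; rewrite inE big_cons => /orP[/eqP<- ->|ir Pi]; first exact: geq_minl.
  by case: ifP => _; [apply: leq_trans (geq_minr _ _) _|]; exact: IH.
(* The minimum has no index above [#|T|]; for such [n] its default value gives the bound. *)
case: (leqP n #|T|) => [nT|/ltnW]; last first.
  apply: leq_trans; rewrite /chromatic_number.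
  elim/big_rec: _ => // i m _; apply: leq_trans; exact: geq_minr.
have nT' : n < #|T|.+1 by [].
apply: (bmin _ _ _ _ _ (Ordinal nT')); first exact: mem_index_enum.
apply/existsP; exists [ffun x => Ordinal (c1 x (in_setT x))].
by apply/'forall_forallP => x y; apply/implyP=> xy; rewrite !ffunE -val_eqE /= c2 ?inE.
Qed.

End Translation.

Theorem theorem1p7 :
  exists f : nat -> nat,
    forall (T : finType) (lt : rel T) (E : rel T),
      simple_graph E -> strict_linear_order lt -> X_free lt E ->
      chromatic_number E <= f (clique_number E).
Proof.
have [f fP] := choice ograph_chi_bounded.
exists (fun w => f w.+1) => T lt E gE olt Xf; apply: chromatic_number_leq.
by apply: (fP _ T (ograph_of gE olt Xf)) => s /= /(size_clique gE).
Qed.
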